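(* Let $X$ be a real reflexive Banach space. If $T:X\to X^*$ is a semimonotone operator, then $T$ is pseudomonotone.
   Context: $X^*$ is the dual of $X$, $\langle\cdot,\cdot\rangle$ the duality pairing $X^*\times X\to\mathbb R$; $\to$ and $\rightharpoonup$ denote norm and weak convergence. $T$-pas: for $T:X\to X^*$, a sequence $(x_n)_{n\in\mathbb N}$ in $X$ is called a $T$-pas if it converges weakly in $X$ to some $x\in X$ and $\limsup_{n\to\infty}\langle Tx_n,x_n-x\rangle\le 0$. Pseudomonotone: $T:X\to X^*$ is pseudomonotone if for every $T$-pas $(x_n)$ converging weakly to $x\in X$ one has $\langle Tx,x-v\rangle\le\liminf_{n\to\infty}\langle Tx_n,x_n-v\rangle$ for every $v\in X$. Radially continuous: $T:X\to X^*$ is radially continuous in $x\in X$ if for every $v\in X$ the map $t\mapsto\langle T(x+tv),v\rangle$ from $\mathbb R$ to $\mathbb R$ is continuous at $t=0$. Semimonotone: $T:X\to X^*$ is semimonotone if $Tx=\widetilde T(x,x)$ for all $x\in X$ for some mapping $\widetilde T:X\times X\to X^*$ (called a semimonotone representative of $T$) satisfying: (S1) $\langle\widetilde T(x,x)-\widetilde T(y,x),x-y\rangle\ge0$ for all $x,y\in X$; (S2) if $(y_n)$ is a $T$-pas with $y_n\rightharpoonup y$, then $\widetilde T(x,y_n)\rightharpoonup\widetilde T(x,y)$ for all $x\in X$; (S3) if $(y_n)$ is a $T$-pas with $y_n\rightharpoonup y$, then $\langle\widetilde T(x,y_n),y_n-y\rangle\to0$ for all $x\in X$; (S4) for all $y\in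 X$, the map $x\mapsto\widetilde T(x,y)$ is radially continuous in the point $x=y$. *)

(* Defs.v *)
From HB Require Import structures.
From mathcomp Require Import all_boot all_order all_algebra.
From mathcomp Require Import all_classical all_reals all_analysis.
Import Order.TTheory GRing.Theory Num.Theory.
Import numFieldNormedType.Exports.

Set Implicit Arguments.
Unset Strict Implicit.
Unset Printing Implicit Defensive.

Local Open Scope classical_set_scope.
Local Open Scope ring_scope.

(** MathComp-Analysis has no type of continuous linear functionals, so the
    dual space is built here as a subtype of [V -> R^o] carrying the pointwise
    operations and the operator norm.  Being again a [normedModType], it can be
    dualised once more. *)

Section DualPred.
Context {R : realType} {V : normedModType R}.

Definition continuous_linear : {pred V -> R^o} :=
  [pred f : V -> R^o | `[< linear f /\ continuous f >] ].

Lemma continuous_linear_submod_closed : submod_closed continuous_linear.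
Proof.
split; first by apply/asboolP; split=> [a u v|x];
  [rewrite /= scaler0 addr0|exact: cvg_cst].
move=> a f g /asboolP[lf cf] /asboolP[lg cg]; apply/asboolP; split.
  move=> b u v; rewrite !fctE lf lg !scalerDr addrACA; congr (_ + _ + _).
  by rewrite !scalerA mulrC.
move=> x; apply: (@cvgD _ R^o); last exact: cg.
by apply: (@cvgZl_tmp _ R^o); exact: cf.
Qed.

HB.instance Definition _ := GRing.isSubmodClosed.Build R (V -> R^o)
  continuous_linear continuous_linear_submod_closed.

End DualPred.

Record dual_space (R : realType) (V : normedModType R) := Dual {
  dual_val :> V -> R^o;
  dual_valP : dual_val \in continuous_linear }.

Section DualNormedModule.
Context {R : realType} {V : normedModType R}.
Implicit Types (f g : dual_space V) (x : V).

HB.instance Definition _ := [isSub for @dual_val R V].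
HB.instance Definition _ := [Choice of dual_space V by <:].
HB.instance Definition _ := [SubChoice_isSubLmodule of dual_space V by <:].

Lemma dual_linear f : linear f.
Proof. by have /asboolP[] := dual_valP f. Qed.

Lemma dual_continuous f : continuous f.
Proof. by have /asboolP[] := dual_valP f. Qed.

HB.instance Definition _ f :=
  GRing.isLinear.Build R V R^o *:%R (dual_val f) (@dual_linear f).

Definition opnorm f : R := sup [set `|f x| | x in [set x | `|x| <= 1]].

Lemma opnorm_has_sup f : has_sup [set `|f x| | x in [set x | `|x| <= 1]].
Proof.
split; first by exists `|f 0|, 0 => //=; rewrite normr0.
have /linear_bounded_continuous/bounded_funP/(_ 1)[M fM] := @dual_continuous f.
by exists M => _ [x /= x1 <-]; exact: fM.
Qed.

Lemma opnorm_ge0 f : 0 <= opnorm f.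
Proof.
by rewrite /opnorm (le_trans (normr_ge0 (f 0)))//; apply: ub_le_sup;
  [case: (opnorm_has_sup f)|exists 0 => //=; rewrite normr0].
Qed.

Lemma opnorm_le f x : `|f x| <= opnorm f * `|x|.
Proof.
have [->|x0] := eqVneq x 0; first by rewrite linear0 !normr0 mulr0.
have nx0 : 0 < `|x| by rewrite normr_gt0.
rewrite -ler_pdivrMr//; apply: ub_le_sup; first by case: (opnorm_has_sup f).
exists (`|x|^-1 *: x) => /=.
  by rewrite normrZ normfV normr_id mulVf ?gt_eqF.
by rewrite linearZ/= normrZ normfV normr_id mulrC.
Qed.

Lemma opnorm_leP f (M : R) :
  (forall x, `|x| <= 1 -> `|f x| <= M) -> opnorm f <= M.
Proof.
move=> fM; apply: ge_sup; first by case: (opnorm_has_sup f).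
by move=> _ [x /= x1 <-]; exact: fM.
Qed.

Lemma opnormD f g : opnorm (f + g) <= opnorm f + opnorm g.
Proof.
apply: opnorm_leP => x x1; rewrite (le_trans (ler_normD _ _))//.
by apply: lerD; rewrite (le_trans (opnorm_le _ _))// ler_piMr// opnorm_ge0.
Qed.

Lemma opnormZ_le (a : R) f : opnorm (a *: f) <= `|a| * opnorm f.
Proof.
apply: opnorm_leP => x x1; rewrite normrZ ler_wpM2l//.
by rewrite (le_trans (opnorm_le _ _))// ler_piMr// opnorm_ge0.
Qed.

Lemma opnormZ (a : R) f : opnorm (a *: f) = `|a| * opnorm f.
Proof.
apply/eqP; rewrite eq_le opnormZ_le/=.
have [->|a0] := eqVneq a 0; first by rewrite normr0 mul0r opnorm_ge0.
rewrite -ler_pdivlMl ?normr_gt0// -normfV.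
by rewrite (le_trans _ (opnormZ_le _ _))// scalerA mulVf// scale1r.
Qed.

Lemma opnorm_eq0 f : opnorm f = 0 -> f = 0.
Proof.
move=> f0; apply/val_inj/funext => x /=.
by apply/eqP; rewrite -normr_le0 (le_trans (opnorm_le f x))// f0 mul0r.
Qed.

HB.instance Definition _ :=
  Lmodule_isNormed.Build R (dual_space V) opnormD opnormZ opnorm_eq0.

End DualNormedModule.

Section Reflexive.
Context {R : realType} (V : normedModType R).

Lemma eval_at_subproof (x : V) :
  (fun f : dual_space V => f x : R^o) \in @continuous_linear R (dual_space V).
Proof.
pose e (f : dual_space V) : R^o := f x.
have le : linear e by [].
pose E : {linear dual_space V -> R^o} := HB.pack e (GRing.isLinear.Build _ _ _ _ _ le).
apply/asboolP; split=> //.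
apply: (@bounded_linear_continuous _ _ _ E); apply/bounded_funP => r.
exists (r * `|x|) => f fr; rewrite (le_trans (opnorm_le f x))//.
exact: ler_wpM2r.
Qed.

Definition eval_at (x : V) : dual_space (dual_space V) := Dual (eval_at_subproof x).

Definition reflexive_space : Prop :=
  forall F : dual_space (dual_space V), exists x : V, eval_at x = F.

End Reflexive.

Definition weak_cvg (R : realType) (V : normedModType R) (u : nat -> V) (l : V)
  : Prop := forall f : dual_space V, f (u n) @[n --> \oo] --> f l.

Section Operators.
Context {R : realType} {X : normedModType R}.
Implicit Types (T : X -> dual_space X) (Tt : X -> X -> dual_space X) (u : nat -> X).

(* The limit superior and inferior are taken in [\bar R], so that no
   boundedness of the sequences is presupposed. *)
Definition T_pas T u : Prop :=
  exists2 x : X, weak_cvg u x &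
    (limn_esup (fun n => (T (u n) (u n - x))%:E) <= 0)%E.

Definition pseudomonotone T : Prop :=
  forall u (x : X), T_pas T u -> weak_cvg u x ->
  forall v : X,
    ((T x (x - v))%:E <= limn_einf (fun n => (T (u n) (u n - v))%:E))%E.

Definition radially_continuous_at T (x : X) : Prop :=
  forall v : X, {for 0, continuous (fun t : R => T (x + t *: v) v : R)}.

Definition semimonotone_representative T Tt : Prop :=
  (forall x, T x = Tt x x) /\
  [/\ (forall x y, 0 <= (Tt x x - Tt y x) (x - y)),
      (forall u y, T_pas T u -> weak_cvg u y ->
         forall x, weak_cvg (fun n => Tt x (u n)) (Tt x y)),
      (forall u y, T_pas T u -> weak_cvg u y ->
         forall x, Tt x (u n) (u n - y) @[n --> \oo] --> (0 : R)) &
      (forall y, radially_continuous_at (fun x => Tt x y) y)].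

Definition semimonotone T : Prop :=
  exists Tt : X -> X -> dual_space X, semimonotone_representative T Tt.

End Operators.

(* Main.v *)
Require Import Defs.
From mathcomp Require Import all_boot all_order all_algebra.
From mathcomp Require Import all_classical all_reals all_analysis.
From mathcomp Require Import lra.
Import Order.TTheory GRing.Theory Num.Theory.
Import numFieldNormedType.Exports.

(** Write [Tt] for a semimonotone representative of [T], let [u n] be a [T]-pas
    with weak limit [x], and fix [v].  The argument is Minty's trick, with the
    monotonicity of [Tt] used in its first variable only.  Test (S1) at [u n]
    against the point [w = x + t (v - x)], [0 < t < 1], of the segment from [x]
    to [v].  Since [u n - w = (1 - t) (u n - x) + t (u n - v)
    = (u n - x) + t (x - v)], it reads

      (1 - t) <T (u n), u n - x> + t <T (u n), u n - v>
        >= <Tt w (u n), u n - x> + t <Tt w (u n), x - v>.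

    As [n] grows, the first term on the left has a nonpositive limit superior
    because [u] is a [T]-pas, the first term on the right tends to [0] by (S3),
    and the second one tends to [t <Tt w x, x - v>] by (S2).  Dividing by [t]
    leaves [<Tt w x, x - v>] as a lower bound for the limit inferior of
    [<T (u n), u n - v>].  Letting [t] decrease to [0] moves [w] to [x] along a
    line through [x], and (S4) turns the bound into [<T x, x - v>].

    A [T]-pas comes with some weak limit, a priori different from a prescribed
    one.  Every functional takes the same value at both ([weak_cvg_unique]), and
    the limit only occurs inside functionals, so they are interchangeable. *)

Local Open Scope classical_set_scope.
Local Open Scope ring_scope.

Section RealSequences.
Context {R : realType}.
Implicit Types (a : nat -> R) (l e : R).

Lemma limn_esup_lt_near a l e : (limn_esup (EFin \o a) <= l%:E)%E -> 0 < e ->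
  \forall n \near \oo, a n < l + e.
Proof.
move=> al e0.
have /ereal_inf_lt[_ [V Voo <-] Vle] : (limn_esup (EFin \o a) < (l + e)%:E)%E.
  by rewrite (le_lt_trans al)// lte_fin ltrDl.
apply: filterS Voo => n Vn; rewrite -lte_fin; apply: le_lt_trans Vle.
by apply: ereal_sup_ubound; exists n.
Qed.

Lemma le_limn_einf_near a l : (forall e, 0 < e -> \forall n \near \oo, l - e <= a n) ->
  (l%:E <= limn_einf (EFin \o a))%E.
Proof.
move=> la; apply/lee_addgt0Pr => e e0; rewrite -leeBlDr// /limn_einf leeNr.
apply: (@le_trans _ _ (ereal_sup [set (- (a n)%:E)%E | n in [set n | l - e <= a n]])).
  by apply: ereal_inf_lbound; exists [set n | l - e <= a n] => //; exact: la.
by apply: ge_ereal_sup => _ [n /= ln <-]; rewrite lee_fin lerN2.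
Qed.

Lemma cvg_dist_near a l e : a @ \oo --> l -> 0 < e ->
  \forall n \near \oo, l - e < a n < l + e.
Proof.
move=> al e0; move/cvgrPdist_lt : al => /(_ _ e0).
by apply: filterS => n; rewrite ltr_distlC.
Qed.

End RealSequences.

(** Uniqueness of real limits gives this much; [x = y] would need functionals to
    separate points. *)
Lemma weak_cvg_unique (R : realType) (V : normedModType R) (u : nat -> V)
    (x y : V) (f : dual_space V) : weak_cvg u x -> weak_cvg u y -> f x = f y.
Proof.
by move=> ux uy; apply: (@cvg_unique R (@Rhausdorff R)) (ux f) (uy f).
Qed.

Section Semimonotone.
Context {R : realType} {X : normedModType R}.
Implicit Types (T : X -> dual_space X) (Tt : X -> X -> dual_space X).
Implicit Types (u : nat -> X) (x v : X).

Lemma T_pas_near T u x (e : R) : T_pas T u -> weak_cvg u x -> 0 < e ->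
  \forall n \near \oo, T (u n) (u n - x) < e.
Proof.
move=> [x0 ux0 pas] ux e0.
have := limn_esup_lt_near (fun n => T (u n) (u n - x0)) 0 e pas e0.
apply: filterS => n; rewrite add0r !raddfB/=.
by rewrite (weak_cvg_unique _ _ _ _ _ (T (u n)) ux ux0).
Qed.

(** (S1) tested at a point of the segment from [x] to [v], with the pairing
    expanded along both decompositions of [y - w]. *)
Lemma semimonotone_segment T Tt x v y (t : R) (w := x + t *: (v - x)) :
  semimonotone_representative T Tt ->
  Tt w y (y - x) + t * Tt w y (x - v) <=
    (1 - t) * T y (y - x) + t * T y (y - v).
Proof.
move=> [TE [S1 _ _ _]].
have mono : 0 <= T y (y - w) - Tt w y (y - w) by rewrite TE; exact: S1.
have wE (f : dual_space X) : f (y - w) = f y - (f x + t * (f v - f x)).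
  by rewrite /w raddfB/= raddfD/= linearZ/= raddfB.
move: mono; rewrite !wE !raddfB/=.
nra.
Qed.

(** Radial continuity pairs with the direction of motion, here [x - v], while
    the segment leaves [x] in the direction [v - x]: it is applied at the
    parameter [- t]. *)
Lemma segment_point_near T Tt x v (e : R) : semimonotone_representative T Tt ->
  0 < e -> exists2 t : R, 0 < t < 1 &
    T x (x - v) - e < Tt (x + t *: (v - x)) x (x - v).
Proof.
move=> [TE [_ _ _ /(_ x (x - v)) S4]] e0.
move/cvgrPdist_lt : S4 => /(_ _ e0)/=.
move=> [d /= d0 dP].
exists (Num.min (d / 2) (1 / 2)).
  by rewrite lt_min gt_min; apply/andP; split; [apply/andP; split; lra|apply/orP; right; lra].
set t := Num.min _ _.
have t0 : 0 < t by rewrite lt_min; apply/andP; split; lra.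
have td : t < d by rewrite gt_min; apply/orP; left; lra.
have := dP (- t); rewrite /ball_/= sub0r opprK gtr0_norm// => /(_ td).
rewrite scale0r addr0 -TE ltr_distlC => /andP[+ _].
by rewrite scaleNr -scalerN opprB.
Qed.

Theorem semimonotone_pseudomonotone T : semimonotone T -> pseudomonotone T.
Proof.
move=> [Tt rep] u x pas ux v; have [TE [_ S2 S3 _]] := rep.
apply: le_limn_einf_near => e e0.
(* Four errors of size [e / 4] add up to [e]; the two that will be divided by
   [t] are bounded by [t * (e / 4)] instead. *)
have e4 : 0 < e / 4 by lra.
have [t /andP[t0 t1] wt] := segment_point_near T Tt x v _ rep e4.
set w := x + t *: _ in wt.
have te : 0 < t * (e / 4) by rewrite mulr_gt0.
have nA := T_pas_near T u x _ pas ux te.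
have nB := cvg_dist_near _ _ _ (S3 u x pas ux w) te.
have nC := cvg_dist_near _ _ _ (S2 u x pas ux w (eval_at (x - v))) e4.
near=> n.
have An : T (u n) (u n - x) < t * (e / 4) by near: n.
have /andP[Bn _] : 0 - t * (e / 4) < Tt w (u n) (u n - x) < 0 + t * (e / 4) by near: n.
have /andP[Cn _] : Tt w x (x - v) - e / 4 < Tt w (u n) (x - v) < Tt w x (x - v) + e / 4
  by near: n.
have S1n := semimonotone_segment T Tt x v (u n) t rep.
have tC : t * (T x (x - v) - e / 4 - e / 4) <= t * Tt w (u n) (x - v).
  by rewrite ler_pM2l//; lra.
have tA : (1 - t) * T (u n) (u n - x) <= t * (e / 4).
  apply: (@le_trans _ _ ((1 - t) * (t * (e / 4)))).
    by apply: ler_wpM2l; [lra|exact: ltW].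
  by apply: ler_piMl; [exact: ltW|lra].
by rewrite -(ler_pM2l t0); rewrite -/w in S1n; lra.
Unshelve. all: by end_near. Qed.

End Semimonotone.

Theorem proposition2p8 (R : realType) (X : completeNormedModType R)
    (X_reflexive : reflexive_space X) (T : X -> dual_space X) :
  semimonotone T -> pseudomonotone T.
Proof. exact: semimonotone_pseudomonotone. Qed.
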